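(* Let $A$ be an integer $2\times2$ matrix with $\Delta_1>0$, $\Delta_2<0$, $\delta_1>0$, $\delta_2<0$ and $|\Delta_1|<|\Delta_2|$, let $\eta>0$, and let $T$ be the horizon. Let $1\le t\le T-1$ and $1\le i\le t$. Then (1) if $s_{i,t}<-|\Delta_2|$ and $y^\ast(s_{i,t+1})=e_R$, then $y^\ast(s_{i,t})=e_R$; (2) if $s_{i,t}>0$ and $y^\ast(s_{i+1,t+1})=e_L$, then $y^\ast(s_{i,t})=e_L$.
   Context: $A=\begin{pmatrix} a_{11} & a_{12} \\ a_{21} & a_{22} \end{pmatrix}$; $\delta_1=a_{11}-a_{12}$, $\delta_2=a_{21}-a_{22}$, $\Delta_1=a_{11}-a_{21}$, $\Delta_2=a_{12}-a_{22}$; $e_L=(1,0)^T$, $e_R=(0,1)^T$. Possible states at time $t$: $s_{i,t}=-(t-i)\Delta_1-(i-1)\Delta_2$, $1\le i\le t$. Payoff function: $r(s,y)=\left(\frac{1}{e^{-\eta s}+1},\frac{e^{-\eta s}}{e^{-\eta s}+1}\right)Ay$. Action $e_L$ leads from $s_{i,t}$ to $s_{i,t+1}$ and $e_R$ leads from $s_{i,t}$ to $s_{i+1,t+1}$. Bellman equation: $f^\ast(s_{i,T+1})=0$ for all $i$ and, for $1\le t\le T$, $f^\ast(s_{i,t})=\max\{r(s_{i,t},e_L)+f^\ast(s_{i,t+1}),\ r(s_{i,t},e_R)+f^\ast(s_{i+1,t+1})\}$ ($f^\ast$ is a function of the node $(i,t)$, not only of the numerical value of the state). The optimal action $y^\ast(s_{i,t})\in\{e_L,e_R\}$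 is the maximizing action, ties being resolved in favour of $e_L$. *)

(* Defs.v *)
From HB Require Import structures.
From mathcomp Require Import all_boot all_order all_algebra.
From mathcomp Require Import reals sequences exp.

Set Implicit Arguments.
Unset Strict Implicit.
Unset Printing Implicit Defensive.

Import Order.TTheory GRing.Theory Num.Theory.
Local Open Scope ring_scope.

(* Row and column indices 1, 2 of the matrix A are 0, 1 : 'I_2.  Nodes (i, t)
   keep their one-based numbering, 1 <= i <= t. *)

Definition delta1 (A : 'M[int]_2) : int := A 0 0 - A 0 1.
Definition delta2 (A : 'M[int]_2) : int := A 1 0 - A 1 1.
Definition Delta1 (A : 'M[int]_2) : int := A 0 0 - A 1 0.
Definition Delta2 (A : 'M[int]_2) : int := A 0 1 - A 1 1.

Definition state (A : 'M[int]_2) (i t : nat) : int :=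
  - (t%:Z - i%:Z) * Delta1 A - (i%:Z - 1) * Delta2 A.

Definition eL {R : realType} : 'cV[R]_2 := delta_mx 0 0.
Definition eR {R : realType} : 'cV[R]_2 := delta_mx 1 0.

Definition mixed {R : realType} (eta s : R) : 'rV[R]_2 :=
  \row_(j < 2) if j == 0 then 1 / (expR (- (eta * s)) + 1)
               else expR (- (eta * s)) / (expR (- (eta * s)) + 1).

Definition payoff {R : realType} (A : 'M[int]_2) (eta s : R) (y : 'cV[R]_2)
    : R :=
  (mixed eta s *m map_mx intr A *m y) 0 0.

(* The value of node (i, t) when k stages remain; backward induction is
   structural in k, and the horizon T corresponds to k = T + 1 - t. *)
Fixpoint value {R : realType} (A : 'M[int]_2) (eta : R) (k i t : nat) : R :=
  if k is k'.+1 then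
    Num.max (payoff A eta (state A i t)%:~R eL + value A eta k' i t.+1)
            (payoff A eta (state A i t)%:~R eR + value A eta k' i.+1 t.+1)
  else 0.

Definition fstar {R : realType} (A : 'M[int]_2) (eta : R) (T i t : nat) : R :=
  value A eta (T.+1 - t) i t.

Definition ystar {R : realType} (A : 'M[int]_2) (eta : R) (T i t : nat)
    : 'cV[R]_2 :=
  if payoff A eta (state A i t)%:~R eR + fstar A eta T i.+1 t.+1
     <= payoff A eta (state A i t)%:~R eL + fstar A eta T i t.+1
  then eL else eR.

Lemma fstar_terminal (R : realType) (A : 'M[int]_2) (eta : R) (T i : nat) :
  fstar A eta T i T.+1 = 0.
Proof. by rewrite /fstar subnn. Qed.

Lemma fstar_bellman (R : realType) (A : 'M[int]_2) (eta : R) (T i t : nat) :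
  (1 <= t <= T)%N ->
  fstar A eta T i t =
    Num.max (payoff A eta (state A i t)%:~R eL + fstar A eta T i t.+1)
            (payoff A eta (state A i t)%:~R eR + fstar A eta T i.+1 t.+1).
Proof. by case/andP=> _ letT; rewrite /fstar subSn // subSS. Qed.

(* Main.v *)
(* Playing L then R, or R then L, from the node (i, t) leads to the same node
   (i+1, t+2).  If y*(s_{i,t+1}) = R, the value of L at (i, t) is attained by
   the order LR, while R is worth at least the order RL; the gap between the
   two orders is
     Delta1 (p(s - Delta2) - p(s)) + Delta2 (p(s) - p(s - Delta1))
   with p(s) = 1 / (1 + exp (- eta s)), i.e. it compares the slopes of two
   adjacent chords of p that meet at s.  Left of 0 the function p is strictly
   convex, which gives (1).  For (2) the roles are exchanged and p is concave
   right of 0; when s < Delta1 the left chord crosses 0, and the symmetry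
   p(-s) = 1 - p(s) reflects its negative part to the right.  As the payoffs are
   integers, convexity is only needed along an arithmetic progression. *)
Require Import Defs.
From HB Require Import structures.
From mathcomp Require Import all_boot all_order all_algebra.
From mathcomp Require Import reals sequences exp.
From mathcomp Require Import zify ring lra.

Set Implicit Arguments.
Unset Strict Implicit.
Unset Printing Implicit Defensive.

Import Order.TTheory GRing.Theory Num.Theory.
Local Open Scope ring_scope.

Section ConcaveSequence.
Variables (R : realDomainType) (f : nat -> R).
Hypothesis f_concave : forall n, f n.+2 - f n.+1 <= f n.+1 - f n.

Lemma concave_step_le m n : (m <= n)%N -> f n.+1 - f n <= f m.+1 - f m.
Proof.
move=> /subnK <-; elim: (n - m)%N => [|k IHk]; first by rewrite add0n.
by rewrite addSn (le_trans _ IHk).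
Qed.

(** Increments decrease, so shifting a window of length [n] to the right by [m] cannot increase its
    rise. *)
Lemma concave_subadd m n : f (m + n)%N - f m <= f n - f 0%N.
Proof.
elim: n => [|n IHn]; first by rewrite addn0 !subrr.
have := concave_step_le (leq_addl m n).
by rewrite addnS; lra.
Qed.

Lemma concave_chord_ub n k : f (n + k)%N - f n <= k%:R * (f n.+1 - f n).
Proof.
elim: k => [|k IHk]; first by rewrite addn0 subrr mul0r.
have := concave_step_le (leq_addr k n).
by rewrite addnS -natr1; lra.
Qed.

Lemma concave_chord_lb m n : (m <= n.+1)%N ->
  m%:R * (f n.+1 - f n) <= f m - f 0%N.
Proof.
elim: m => [|m IHm] lt_mn; first by rewrite subrr mul0r.
have := concave_step_le (lt_mn : (m <= n)%N); have := IHm (ltnW lt_mn).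
by rewrite -natr1; lra.
Qed.

(** The chords over [[0, a]] and [[a, b]] are both compared with the single step at [a];
    cross-multiplying avoids division. *)
Lemma concave_slope_le a b : (a <= b)%N ->
  a%:R * (f b - f 0%N) <= b%:R * (f a - f 0%N).
Proof.
move=> /subnKC <-; set k := (b - a)%N.
have lb := concave_chord_lb (leqnSn a); have ub := concave_chord_ub a k.
have := ler_wpM2l (ler0n R k) lb; have := ler_wpM2l (ler0n R a) ub.
by rewrite natrD; lra.
Qed.

End ConcaveSequence.

(** Strictness comes from the junction alone: the last step of the left chord strictly exceeds the
    first step of the right one. *)
Lemma concave_adjacent_lt (R : realDomainType) (f : nat -> R) a b :
    (forall n, f n.+2 - f n.+1 < f n.+1 - f n) -> (0 < a)%N -> (0 < b)%N ->
  b%:R * (f (b + a)%N - f b) < a%:R * (f b - f 0%N).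
Proof.
move=> f_lt a_gt0; case: b => // b _.
have f_le n := ltW (f_lt n).
have ub := ler_wpM2l (ler0n R b.+1) (concave_chord_ub f_le b.+1 a).
have lb := ler_wpM2l (ler0n R a) (concave_chord_lb f_le (leqnn b.+1)).
have ab_gt0 : 0 < a%:R * b.+1%:R :> R by rewrite mulr_gt0 ?ltr0n.
have := f_lt b; rewrite -(ltr_pM2l ab_gt0) => gap.
by apply: le_lt_trans ub _; apply: lt_le_trans lb; rewrite mulrCA !mulrA.
Qed.

Section Logistic.
Variable R : realType.
Implicit Types (x h eta : R) (a b c n : nat).

Definition logistic x : R := 1 / (expR (- x) + 1).

Lemma logisticN x : logistic (- x) = 1 - logistic x.
Proof.
rewrite /logistic opprK expRN.
have e_gt0 := expR_gt0 x.
by field; rewrite !gt_eqF ?addr_gt0.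
Qed.

Lemma logistic_concave x h : 0 <= x -> 0 < h ->
  logistic (x + h + h) - logistic (x + h) < logistic (x + h) - logistic x.
Proof.
move=> x_ge0 h_gt0; rewrite /logistic !opprD !expRD.
set u := expR (- x); set q := expR (- h).
have u_gt0 : 0 < u := expR_gt0 _; have q_gt0 : 0 < q := expR_gt0 _.
have u_le1 : u <= 1 by rewrite -expR0 ler_expR oppr_le0.
have q_lt1 : q < 1 by rewrite -expR0 ltr_expR oppr_lt0.
have uq_gt0 : 0 < u * q by rewrite mulr_gt0.
have uqq_gt0 : 0 < u * q * q by rewrite mulr_gt0.
have uq_lt1 : u * q < 1 by nra.
rewrite -subr_gt0.
(* The factored second difference has the sign of [1 - u * q]; this is where [0 <= x] enters. *)
have -> : 1 / (u * q + 1) - 1 / (u + 1) - (1 / (u * q * q + 1) - 1 / (u * q + 1))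
    = u * (1 - q) ^+ 2 * (1 - u * q)
      / ((u + 1) * (u * q + 1) * (u * q * q + 1)).
  by field; rewrite !gt_eqF ?addr_gt0.
by rewrite divr_gt0 ?mulr_gt0 ?exprn_gt0 ?subr_gt0 ?addr_gt0.
Qed.

Lemma logistic_seq_concave eta c n : 0 < eta ->
  logistic (eta * (c + n.+2)%:R) - logistic (eta * (c + n.+1)%:R)
  < logistic (eta * (c + n.+1)%:R) - logistic (eta * (c + n)%:R).
Proof.
move=> eta_gt0; rewrite !addnS -!natr1 !mulrDr mulr1.
by apply: logistic_concave => //; rewrite mulr_ge0 ?ler0n // ltW.
Qed.

Lemma logistic_slope_neg eta a b c : 0 < eta -> (0 < a)%N -> (0 < b)%N ->
  b%:R * (logistic (eta * - (c + b)%:R) - logistic (eta * - (c + (b + a))%:R))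
  < a%:R * (logistic (eta * - c%:R) - logistic (eta * - (c + b)%:R)).
Proof.
move=> eta_gt0 a_gt0 b_gt0; rewrite !mulrN !logisticN.
have := concave_adjacent_lt (fun n => logistic_seq_concave c n eta_gt0)
  a_gt0 b_gt0.
by rewrite addn0; lra.
Qed.

Lemma logistic_slope_pos eta a b n : 0 < eta -> (a <= b)%N ->
  a%:R * (logistic (eta * (n + b)%:R) - logistic (eta * n%:R))
  <= b%:R * (logistic (eta * n%:R) - logistic (eta * (n%:R - a%:R))).
Proof.
move=> eta_gt0 le_ab.
have concave c k := ltW (logistic_seq_concave c k eta_gt0).
have [le_an | /ltnW le_na] := leqP a n.
  (* Both chords lie right of 0: shift the chord of length [b] back to start at [c = n - a], then
     compare chords with common origin [c]. *)
  rewrite -natrB //; move: (n - a)%N (subnK le_an) => c <-.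
  have := ler_wpM2l (ler0n R a) (concave_subadd (concave c) a b).
  have := concave_slope_le (concave c) le_ab.
  by rewrite addn0 addnA; lra.
(* The left chord crosses 0. After reflection its rise is [p(n) + p(a - n) - 2 p(0)], since
   [p(0) = 1 / 2], and subadditivity bounds this below by [p(a) - p(0)]. *)
rewrite -[n%:R - _]opprB -natrB // mulrN logisticN.
have half : logistic (eta * 0%:R) = 1 / 2 by rewrite /logistic mulr0 oppr0 expR0.
have := ler_wpM2l (ler0n R a) (concave_subadd (concave 0%N) n b).
have := concave_slope_le (concave 0%N) le_ab.
have := ler_wpM2l (ler0n R b) (concave_subadd (concave 0%N) n (a - n)).
by rewrite !add0n subnKC // half; lra.
Qed.

End Logistic.

Lemma payoff_eL (R : realType) (A : 'M[int]_2) (eta s : R) :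
  payoff A eta s eL = (A 1 0)%:~R + logistic (eta * s) * (Delta1 A)%:~R.
Proof.
have e_gt0 := expR_gt0 (- (eta * s)).
rewrite /payoff /eL -colE !mxE !big_ord_recl big_ord0 !mxE /= /Delta1 rmorphB /=.
rewrite (_ : lift ord0 ord0 = 1); last exact: val_inj.
by rewrite /logistic; field; rewrite gt_eqF ?addr_gt0.
Qed.

Lemma payoff_eR (R : realType) (A : 'M[int]_2) (eta s : R) :
  payoff A eta s eR = (A 1 1)%:~R + logistic (eta * s) * (Delta2 A)%:~R.
Proof.
have e_gt0 := expR_gt0 (- (eta * s)).
rewrite /payoff /eR -colE !mxE !big_ord_recl big_ord0 !mxE /= /Delta2 rmorphB /=.
rewrite (_ : lift ord0 ord0 = 1); last exact: val_inj.
by rewrite /logistic; field; rewrite gt_eqF ?addr_gt0.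
Qed.

Lemma state_eL A i t : state A i t.+1 = state A i t - Delta1 A.
Proof. by rewrite /state; lia. Qed.

Lemma state_eR A i t : state A i.+1 t.+1 = state A i t - Delta2 A.
Proof. by rewrite /state; lia. Qed.

Lemma eL_neq_eR (R : realType) : eL != eR :> 'cV[R]_2.
Proof.
apply/eqP => /matrixP/(_ 0 0); rewrite !mxE /= => /eqP.
by rewrite oner_eq0.
Qed.

Section Policy.
Variables (R : realType) (A : 'M[int]_2) (eta : R) (T i t : nat).

Definition gainL := payoff A eta (state A i t)%:~R eL + fstar A eta T i t.+1.
Definition gainR := payoff A eta (state A i t)%:~R eR + fstar A eta T i.+1 t.+1.

Lemma ystar_eL : ystar A eta T i t = eL <-> gainR <= gainL.
Proof.
rewrite /ystar -/gainL -/gainR; case: ifP => // _; split=> // /esym/eqP.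
by rewrite (negbTE (eL_neq_eR R)).
Qed.

(** Ties go to [eL], so choosing [eR] needs a strict gain; hence (1) uses a strict slope comparison
    and (2) a weak one. *)
Lemma ystar_eR : ystar A eta T i t = eR <-> gainL < gainR.
Proof.
rewrite /ystar -/gainL -/gainR; case: ltP => // _; split=> // /eqP.
by rewrite (negbTE (eL_neq_eR R)).
Qed.

Lemma fstar_gain : (1 <= t <= T)%N -> fstar A eta T i t = Num.max gainL gainR.
Proof. exact: fstar_bellman. Qed.

End Policy.

Theorem corollary5p1 (R : realType) (A : 'M[int]_2) (eta : R) (T i t : nat)
    (hDelta1 : 0 < Delta1 A) (hDelta2 : Delta2 A < 0)
    (hdelta1 : 0 < delta1 A) (hdelta2 : delta2 A < 0)
    (hDelta : `|Delta1 A| < `|Delta2 A|)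
    (heta : 0 < eta)
    (ht : (1 <= t <= T - 1)%N) (hi : (1 <= i <= t)%N) :
  (state A i t < - `|Delta2 A| ->
     ystar A eta T i t.+1 = eR -> ystar A eta T i t = eR) /\
  (0 < state A i t ->
     ystar A eta T i.+1 t.+1 = eL -> ystar A eta T i t = eL).
Proof.
(* The Bellman equation is thus available at both successors of [(i, t)]. *)
have lt_tT : (1 <= t.+1 <= T)%N by lia.
have [a [a_gt0 Da]] : exists a, (0 < a)%N /\ Delta1 A = a%:Z.
  by exists `|Delta1 A|%N; lia.
have [b [b_gt0 Db]] : exists b, (0 < b)%N /\ Delta2 A = - b%:Z.
  by exists `|Delta2 A|%N; lia.
have le_ab : (a <= b)%N by lia.
set s := state A i t.
split=> [s_lt | s_gt0].
  (* Here [- c] is the state after [eR]; the bound on [s] keeps it left of 0. *)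
  have [c Ds] : exists c : nat, s = - (c + b)%N%:Z.
    by exists (absz (s + b%:Z)); rewrite /s; lia.
  move=> /ystar_eR next_R; apply/ystar_eR.
  rewrite /gainL /gainR !fstar_gain // (max_idPr (ltW next_R)).
  (* Bound the value of R below by the order RL; its continuation value is that of LR and
     cancels. *)
  apply: (@lt_le_trans _ _ (payoff A eta s%:~R eR + gainL A eta T i.+1 t.+1));
    last by rewrite lerD2l le_max lexx.
  rewrite /gainL /gainR !payoff_eL !payoff_eR state_eR state_eL -/s Da Db.
  have -> : s - a%:Z = - (c + (b + a))%N%:Z by lia.
  have -> : s - - b%:Z = - c%:Z by lia.
  rewrite Ds !rmorphN /= -!pmulrn.
  by have := logistic_slope_neg c heta a_gt0 b_gt0; lra.
have [n Ds] : exists n : nat, s = n%:Z by exists `|s|%N; rewrite /s; lia.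
move=> /ystar_eL next_L; apply/ystar_eL.
rewrite /gainL /gainR !fstar_gain // (max_idPl next_L).
apply: (@le_trans _ _ (payoff A eta s%:~R eL + gainR A eta T i t.+1));
  last by rewrite lerD2l le_max lexx orbT.
rewrite /gainL /gainR !payoff_eL !payoff_eR state_eR state_eL -/s Da Db.
have -> : s - - b%:Z = (n + b)%N%:Z by lia.
rewrite Ds rmorphB rmorphN /= -!pmulrn.
by have := logistic_slope_pos n heta le_ab; lra.
Qed.
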